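(* Let $k\ge0$ and let $u_h,\omega_h,\rho_h$ (functions of time $s$ with values in $V_h^k$) be a solution of the semi-discrete local discontinuous Galerkin scheme for the coupled dispersionless system $\rho_s+u\omega=0$, $\omega_s=\rho u$, $\omega=u_y$ on $I=[y_L,y_R]$: for all test functions $\phi,\varphi,\psi\in V_h^k$ and all cells $I_j$, $1\le j\le N$, $$((\rho_h)_s,\phi)_{I_j}+(u_h\omega_h,\phi)_{I_j}=0,$$ $$((\omega_h)_s,\varphi)_{I_j}=(\rho_hu_h,\varphi)_{I_j},$$ $$(\omega_h,\psi)_{I_j}=\langle\widehat{u_h},\psi\rangle_{I_j}-(u_h,\psi_y)_{I_j},$$ with numerical flux $\widehat{u_h}=u_h^+$. Then the scheme preserves the quantity $$H_1(\rho_h,\omega_h)=\int_I(\rho_h^2+\omega_h^2)\,dy,$$ that is, $\frac{d}{ds}H_1(\rho_h,\omega_h)=0$.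
   Context: The interval $I=[y_L,y_R]$ is partitioned into cells $I_j=[y_{j-1/2},y_{j+1/2}]$, $j=1,\dots,N$, with $y_{1/2}=y_L$, $y_{N+1/2}=y_R$. $V_h^k$ is the space of functions $v$ on $I$ with $v|_{I_j}\in P^k(I_j)$ for all $j$ (polynomials of degree at most $k$ on each cell, possibly discontinuous across interfaces). $u^-_{j+1/2}$ and $u^+_{j+1/2}$ denote the values of $u$ at $y_{j+1/2}$ from the left cell $I_j$ and the right cell $I_{j+1}$; at the right endpoint $y_{N+1/2}$ the value $(u_h)^+_{N+1/2}$ is supplied by the boundary condition. For each cell, $(u,v)_{I_j}=\int_{I_j}uv\,dy$ and $\langle\hat u,v\rangle_{I_j}=\hat u_{j+1/2}v^-_{j+1/2}-\hat u_{j-1/2}v^+_{j-1/2}$. Subscript $s$ denotes the time derivative, and the semi-discrete solution is differentiable in time. *)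

(* Defs.v *)
From HB Require Import structures.
From mathcomp Require Import all_boot all_order all_algebra.
From mathcomp Require Import all_classical all_reals all_analysis.

Set Implicit Arguments.
Unset Strict Implicit.
Unset Printing Implicit Defensive.

Import Order.TTheory GRing.Theory Num.Theory.
Import numFieldNormedType.Exports.

Local Open Scope classical_set_scope.
Local Open Scope ring_scope.

Section LDG.
Context {R : realType}.
Implicit Types (y : nat -> R) (f g v : R -> R).

(* The nodes are indexed from 0: [y i] is y_{i+1/2}, and the cell of index j,
   0 <= j < N, is [y j, y j.+1], i.e. I_{j+1} in 1-based numbering. *)
Definition is_mesh (yL yR : R) (N : nat) y : Prop :=
  [/\ (0 < N)%N, y 0%N = yL, y N = yR &
      forall j, (j < N)%N -> y j < y j.+1].

(* The value of v at an interface is left unconstrained: v is polynomial on each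
   open cell, and at a node only the one-sided traces below are meaningful. *)
Definition Vh (N : nat) y (k : nat) : set (R -> R) :=
  [set v | forall j, (j < N)%N ->
    exists2 p : {poly R}, (size p <= k.+1)%N &
      {in `]y j, y j.+1[, forall x, v x = p.[x]}].

Definition trace_l v (x : R) : R := lim (v z @[z --> x^'-]).
Definition trace_r v (x : R) : R := lim (v z @[z --> x^'+]).

Definition inner_cell y (j : nat) f g : R :=
  \int[lebesgue_measure]_(x in `[y j, y j.+1]) (f x * g x).

(* [uhat i] is the single-valued flux at the node [y i]. *)
Definition flux_cell y (j : nat) (uhat : nat -> R) v : R :=
  uhat j.+1 * trace_l v (y j.+1) - uhat j * trace_r v (y j).

(* The flux u^+; at the last node the right value is the boundary datum b. *)
Definition flux_plus (N : nat) y (b : R) v (i : nat) : R :=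
  if i == N then b else trace_r v (y i).

Definition time_deriv (w : R -> R -> R) (s x : R) : R :=
  derive1 (fun t => w t x) s.

(* Interface points are excluded, as elements of Vh have no values there. *)
Definition time_differentiable (N : nat) y (J : set R) (w : R -> R -> R) : Prop :=
  forall s, J s -> forall j, (j < N)%N -> forall x, x \in `]y j, y j.+1[ ->
    derivable (fun t => w t x) s 1.

(* [J] is the set of times, [b s] the boundary value (u_h)^+ at y_R at time s;
   a time-dependent function w is applied as [w s x]. *)
Record LDG_solution (N : nat) y (k : nat) (J : set R) (b : R -> R)
    (u omega rho : R -> R -> R) : Prop := {
  ldg_Vh_u : forall s, J s -> Vh N y k (u s);
  ldg_Vh_omega : forall s, J s -> Vh N y k (omega s);
  ldg_Vh_rho : forall s, J s -> Vh N y k (rho s);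
  ldg_diff_u : time_differentiable N y J u;
  ldg_diff_omega : time_differentiable N y J omega;
  ldg_diff_rho : time_differentiable N y J rho;
  ldg_eq_rho : forall s, J s -> forall phi, Vh N y k phi ->
    forall j, (j < N)%N ->
      inner_cell y j (time_deriv rho s) phi
      + inner_cell y j (u s \* omega s) phi = 0;
  ldg_eq_omega : forall s, J s -> forall phi, Vh N y k phi ->
    forall j, (j < N)%N ->
      inner_cell y j (time_deriv omega s) phi
      = inner_cell y j (rho s \* u s) phi;
  ldg_eq_u : forall s, J s -> forall psi, Vh N y k psi ->
    forall j, (j < N)%N ->
      inner_cell y j (omega s) psi
      = flux_cell y j (flux_plus N y (b s) (u s)) psi
        - inner_cell y j (u s) (derive1 psi)
}.

Definition H1 (yL yR : R) (rho omega : R -> R) : R :=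
  \int[lebesgue_measure]_(x in `[yL, yR]) (rho x ^+ 2 + omega x ^+ 2).

End LDG.

(* Main.v *)
(* Test the first two equations of the scheme with [rho] and [omega] on a cell:
   the two nonlinear terms are then the integrals of the same function
   [rho u omega] with opposite signs, so the derivative of the cell energy
   vanishes.  The differentiation under the integral sign is elementary: by
   Lagrange interpolation at [k + 1] points of the open cell, a function of time
   with values in polynomials of degree at most [k] is a combination of fixed
   polynomials whose coefficients are its values at these points, so the energy
   is a quadratic form in finitely many differentiable functions of time. *)
Require Import Defs.
From mathcomp Require Import all_boot all_order all_algebra.
From mathcomp Require Import all_classical all_reals all_analysis.
From mathcomp Require Import measurable_realfun qpoly ring.
Import Order.TTheory GRing.Theory Num.Theory.
Import numFieldNormedType.Exports.
Local Open Scope classical_set_scope.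
Local Open Scope ring_scope.

Set Implicit Arguments.
Unset Strict Implicit.

Definition poly_int {R : realType} (a b : R) (p : {poly R}) : R :=
  \int[lebesgue_measure]_(x in `[a, b]) p.[x].

Lemma integrable_horner {R : realType} (a b : R) (p : {poly R}) :
  (lebesgue_measure : measure _ _).-integrable `[a, b] (fun x => (p.[x])%:E).
Proof.
apply: continuous_compact_integrable; first exact: segment_compact.
by apply: continuous_subspaceT => x; exact: continuous_horner.
Qed.

Lemma poly_intD {R : realType} (a b : R) (p q : {poly R}) :
  poly_int a b (p + q) = poly_int a b p + poly_int a b q.
Proof.
rewrite /poly_int -RintegralD//; [|exact: integrable_horner..].
by apply: eq_Rintegral => x _; rewrite hornerD.
Qed.

Lemma poly_intZ {R : realType} (a b c : R) (p : {poly R}) :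
  poly_int a b (c *: p) = c * poly_int a b p.
Proof.
rewrite /poly_int -RintegralZl//; [|exact: integrable_horner].
by apply: eq_Rintegral => x _; rewrite hornerZ.
Qed.

Lemma poly_int_sum {R : realType} (a b : R) (n : nat) (p : 'I_n -> {poly R}) :
  poly_int a b (\sum_(i < n) p i) = \sum_(i < n) poly_int a b (p i).
Proof.
apply: (big_morph _ (poly_intD a b)).
by rewrite -[X in poly_int _ _ X](scale0r (0 : {poly R})) poly_intZ mul0r.
Qed.

Lemma poly_int_mul_sum {R : realType} (a b : R) (n : nat)
    (L : 'I_n -> {poly R}) (c d : 'I_n -> R) :
  poly_int a b ((\sum_(i < n) c i *: L i) * (\sum_(l < n) d l *: L l)) =
  \sum_(i < n) \sum_(l < n) c i * d l * poly_int a b (L i * L l).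
Proof.
rewrite big_distrlr/= poly_int_sum; apply: eq_bigr => i _.
rewrite poly_int_sum; apply: eq_bigr => l _.
by rewrite -scalerAl -scalerAr scalerA poly_intZ.
Qed.

(** Expanding the square gives a quadratic form in the [c i t] whose Gram matrix is constant in
    time. The product rule and the symmetry of this form produce the factor 2. *)
Lemma is_derive_poly_int_sqr {R : realType} (a b s : R) (n : nat)
    (L : 'I_n -> {poly R}) (c : 'I_n -> R -> R) (dc : 'I_n -> R) :
  (forall i, is_derive s 1 (c i) (dc i)) ->
  is_derive s 1
    (fun t => poly_int a b
      ((\sum_(i < n) c i t *: L i) * (\sum_(i < n) c i t *: L i)))
    (2 * poly_int a b
      ((\sum_(i < n) dc i *: L i) * (\sum_(i < n) c i s *: L i))).
Proof.
move=> dcP; pose G i l := poly_int a b (L i * L l).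
have -> : (fun t => poly_int a b
    ((\sum_(i < n) c i t *: L i) * (\sum_(i < n) c i t *: L i))) =
    \sum_(i < n) \sum_(l < n) (c i * c l * cst (G i l)).
  apply/funext => t; rewrite poly_int_mul_sum fct_sumE; apply: eq_bigr => i _.
  by rewrite fct_sumE.
apply: is_derive_eq.
(* The factor 2 becomes two copies, one with its factors swapped, to match the two terms of the
   product rule. *)
rewrite mulr2n mulrDl mul1r {1}[_ * \sum_(i < n) _]mulrC !poly_int_mul_sum.
rewrite -big_split/=; apply: eq_bigr => i _.
rewrite -big_split/=; apply: eq_bigr => l _.
rewrite /G /GRing.scale/=; ring.
Qed.

(** The endpoints form a null set, so arbitrary values of [f] there affect neither measurability nor
    the integral. *)
Lemma integral_eq_poly {R : realType} (a b : R) (f : R -> R) (p : {poly R}) :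
  {in `]a, b[, forall x, f x = p.[x]} ->
  measurable_fun `[a, b] f /\
  (\int[lebesgue_measure]_(x in `[a, b]) (f x)%:E = (poly_int a b p)%:E)%E.
Proof.
move=> fp.
have mp : measurable_fun `]a, b[ (horner p).
  apply: measurable_funTS; apply: continuous_measurable_fun.
  exact: continuous_horner.
have mf : measurable_fun `]a, b[ f.
  by apply: eq_measurable_fun mp => x; rewrite inE/= => /fp.
split; first exact: measurable_fun_itv_cc mf.
rewrite /poly_int /Rintegral fineK; last first.
  by apply: integrable_fin_num => //; exact: integrable_horner.
rewrite integral_itv_bndoo; last exact/measurable_EFinP.
rewrite [RHS]integral_itv_bndoo; last exact/measurable_EFinP.
by apply: eq_integral => x; rewrite inE/= => /fp ->.
Qed.

Lemma Rintegral_eq_poly {R : realType} (a b : R) (f : R -> R) (p : {poly R}) :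
  {in `]a, b[, forall x, f x = p.[x]} ->
  \int[lebesgue_measure]_(x in `[a, b]) f x = poly_int a b p.
Proof. by move=> /integral_eq_poly[_ fp]; rewrite /Rintegral fp. Qed.

Lemma Rintegral_piecewise_poly {R : realType} (n : nat) (y : nat -> R)
    (f : R -> R) (p : nat -> {poly R}) :
  (forall j, (j < n)%N -> y j < y j.+1) ->
  (forall j, (j < n)%N -> {in `]y j, y j.+1[, forall x, f x = (p j).[x]}) ->
  \int[lebesgue_measure]_(x in `[y 0%N, y n]) f x =
  \sum_(j < n) poly_int (y j) (y j.+1) (p j).
Proof.
move=> yS fp.
suff [_] : measurable_fun `[y 0%N, y n] f /\
    (\int[lebesgue_measure]_(x in `[y 0%N, y n]) (f x)%:E =
     (\sum_(j < n) poly_int (y j) (y j.+1) (p j))%:E)%E.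
  by rewrite /Rintegral => ->.
(* The induction also carries the order of the end nodes, to split the interval at [y n], and
   measurability, for additivity of the integral. *)
suff [_ []//] : y 0%N <= y n /\ (measurable_fun `[y 0%N, y n] f /\
    (\int[lebesgue_measure]_(x in `[y 0%N, y n]) (f x)%:E =
     (\sum_(j < n) poly_int (y j) (y j.+1) (p j))%:E)%E).
elim: n yS fp => [_ _|n IH yS fp].
  rewrite big_ord0 set_itv1 integral_set1; split => //; split => //.
  exact: measurable_fun_set1.
have [|j jn|y0n [mf intf]] := IH.
- by move=> j jn; exact/yS/ltnW.
- exact/fp/ltnW.
have yn := yS n (leqnn _).
have [mg intg] := integral_eq_poly (fp n (leqnn _)).
(* The last cell is taken half-open so that the two pieces are disjoint. *)
have mg' : measurable_fun `]y n, y n.+1] f by exact: measurable_fun_itv_oc mg.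
have splitE : `[y 0%N, y n.+1]%classic = `[y 0%N, y n] `|` `]y n, y n.+1].
  by apply: itv_bndbnd_setU; rewrite bnd_simp// ltW.
have mU : measurable_fun (`[y 0%N, y n] `|` `]y n, y n.+1]) f.
  by apply/measurable_funU.
split; first exact/ltW/(le_lt_trans y0n).
split; first by rewrite splitE.
rewrite splitE integral_setU//; last 2 first.
- exact/measurable_EFinP.
- apply/disj_setPS => x [/=]; rewrite !in_itv/= => /andP[_ xn] /andP[].
  by rewrite ltNge xn.
rewrite intf integral_itv_obnd_cbnd; last exact/measurable_EFinP.
by rewrite intg -EFinD big_ord_recr.
Qed.

(** The coefficients are values of [w] at fixed points of the cell, so they inherit
    differentiability in time from [w], and [time_deriv w s] is again polynomial on the cell. *)
Lemma cell_expansion {R : realType} (a b s : R) (k : nat) (J : set R)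
    (w : R -> R -> R) :
  a < b -> open J -> J s ->
  (forall t, J t -> exists2 p : {poly R}, (size p <= k.+1)%N &
    {in `]a, b[, forall x, w t x = p.[x]}) ->
  (forall x, x \in `]a, b[ -> derivable (fun t => w t x) s 1) ->
  exists (L : 'I_k.+1 -> {poly R}) (c : 'I_k.+1 -> R -> R) (dc : 'I_k.+1 -> R),
    [/\ forall i, is_derive s 1 (c i) (dc i),
        forall t, J t ->
          {in `]a, b[, forall x, w t x = (\sum_(i < k.+1) c i t *: L i).[x]} &
        {in `]a, b[, forall x,
          time_deriv w s x = (\sum_(i < k.+1) dc i *: L i).[x]}].
Proof.
move=> ab oJ Js wp dw.
(* Denominators starting at 2 keep all these distinct points strictly between [a] and [b]. *)
pose z (i : nat) : R := a + (b - a) / i.+2%:R.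
have zab i : z i \in `]a, b[.
  rewrite in_itv/= /z ltrDl divr_gt0 ?subr_gt0//=.
  by rewrite -ltrBrDl ltr_pdivrMr// ltr_pMr ?subr_gt0// ltr1n.
have z_inj : injective z.
  have ba0 : b - a != 0 by rewrite subr_eq0 gt_eqF.
  by move=> i l /addrI/(mulfI ba0)/invr_inj/eqP; rewrite eqr_nat => /eqP[].
pose L (i : 'I_k.+1) : {poly R} := tnth (qpoly.lagrange k.+1 z) i.
pose c (i : 'I_k.+1) (t : R) := w t (z i).
have wE t : J t ->
    {in `]a, b[, forall x, w t x = (\sum_(i < k.+1) c i t *: L i).[x]}.
  move=> Jt x xab; have [p sp pE] := wp _ Jt.
  rewrite pE// [in LHS](@lagrange_gen _ k.+1 z _ z_inj p sp)//.
  congr (_.[x]); apply: eq_bigr => i _.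
  by rewrite mul_polyC /c pE.
have dcP i : is_derive s 1 (c i) (time_deriv w s (z i)).
  by apply: DeriveDef; [exact: dw|rewrite /time_deriv derive1E].
exists L, c, (fun i => time_deriv w s (z i)); split => // x xab.
rewrite horner_sum {1}/time_deriv derive1E.
(* The expansion holds only for times in [J]; as [J] is open this covers all times near [s], which
   is enough to differentiate it at fixed [x]. *)
rewrite (@near_eq_derive _ _ _ _ (\sum_(i < k.+1) (c i * cst (L i).[x]))).
  apply: derive_val; apply: is_derive_eq.
  apply: eq_bigr => i _; rewrite /GRing.scale/= hornerZ; ring.
near=> t; rewrite wE//; last by near: t; exact: open_nbhs_nbhs.
by rewrite horner_sum fct_sumE; apply: eq_bigr => i _; rewrite hornerZ.
Unshelve. all: by end_near. Qed.

Lemma is_derive_inner_cell_sqr {R : realType} (N k j : nat) (y : nat -> R)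
    (J : set R) (w : R -> R -> R) (s : R) :
  (j < N)%N -> y j < y j.+1 -> open J -> J s ->
  (forall t, J t -> Vh N y k (w t)) -> time_differentiable N y J w ->
  is_derive s 1 (fun t => inner_cell y j (w t) (w t))
    (2 * inner_cell y j (time_deriv w s) (w s)).
Proof.
move=> jN yj oJ Js Vw dw.
have [||L [c [dc [dcP wE dwE]]]] := @cell_expansion _ _ _ s k _ w yj oJ Js.
- by move=> t Jt; exact: Vw.
- by move=> x; exact: dw.
rewrite [inner_cell _ _ _ _](@Rintegral_eq_poly _ _ _ _
  ((\sum_(i < k.+1) dc i *: L i) * (\sum_(i < k.+1) c i s *: L i))); last first.
  by move=> x xj; rewrite hornerM dwE// wE.
apply: near_eq_is_derive (is_derive_poly_int_sqr _ _ _ dcP).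
near=> t; apply/esym/Rintegral_eq_poly => x xj.
by rewrite hornerM wE//; near: t; exact: open_nbhs_nbhs.
Unshelve. all: by end_near. Qed.

Lemma H1_sum_cells {R : realType} (yL yR : R) (N k : nat) (y : nat -> R)
    (f g : R -> R) :
  is_mesh yL yR N y -> Vh N y k f -> Vh N y k g ->
  H1 yL yR f g = \sum_(j < N) (inner_cell y j f f + inner_cell y j g g).
Proof.
move=> [_ <- <- yS] Vf Vg.
have /choice[p pP] : forall j, exists p : {poly R}, (j < N)%N ->
    {in `]y j, y j.+1[, forall x, f x = p.[x]}.
  (* The zero polynomial is a dummy value beyond the mesh, since choice needs a polynomial for every
     [j]. *)
  move=> j; have [jN|_] := ltnP j N; last by exists 0.
  by have [p _ pE] := Vf j jN; exists p.
have /choice[q qP] : forall j, exists q : {poly R}, (j < N)%N ->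
    {in `]y j, y j.+1[, forall x, g x = q.[x]}.
  move=> j; have [jN|_] := ltnP j N; last by exists 0.
  by have [q _ qE] := Vg j jN; exists q.
rewrite /H1.
rewrite (@Rintegral_piecewise_poly _ N y _ (fun j => p j * p j + q j * q j))//.
  apply: eq_bigr => j _; rewrite poly_intD /inner_cell.
  congr (_ + _); apply/esym/Rintegral_eq_poly => x xj.
    by rewrite hornerM (pP j).
  by rewrite hornerM (qP j).
by move=> j jN x xj; rewrite hornerD !hornerM (pP j)// (qP j).
Qed.

Unset Implicit Arguments.

Theorem proposition2p3 (R : realType) (yL yR : R) (N : nat) (y : nat -> R)
    (k : nat) (J : set R) (b : R -> R) (u omega rho : R -> R -> R)
    (hmesh : is_mesh yL yR N y)
    (hJ : open J)
    (hsol : LDG_solution N y k J b u omega rho) :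
  forall s : R, J s ->
    is_derive s 1 (fun t : R => H1 yL yR (rho t) (omega t)) 0.
Proof.
move=> s Js; have [_ _ _ yS] := hmesh.
case: hsol => _ Vomega Vrho _ domega drho eq_rho eq_omega _.
pose E (j : 'I_N) t := inner_cell y j (rho t) (rho t).
pose F (j : 'I_N) t := inner_cell y j (omega t) (omega t).
apply: (@near_eq_is_derive _ _ _ (\sum_(j < N) (E j + F j))).
  near=> t; have Jt : J t by near: t; exact: open_nbhs_nbhs.
  by rewrite (H1_sum_cells hmesh (Vrho _ Jt) (Vomega _ Jt)) fct_sumE.
have dE (j : 'I_N) : is_derive s 1 (E j)
    (2 * inner_cell y j (time_deriv rho s) (rho s)).
  by apply: (@is_derive_inner_cell_sqr _ N k j y J) => //; exact: yS.
have dF (j : 'I_N) : is_derive s 1 (F j)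
    (2 * inner_cell y j (time_deriv omega s) (omega s)).
  by apply: (@is_derive_inner_cell_sqr _ N k j y J) => //; exact: yS.
apply: is_derive_eq (is_derive_sum (fun j => is_deriveD (dE j) (dF j))) _.
apply: big1 => j _.
(* This equality holds pointwise, so no integrability of the triple product is needed. *)
have cross : inner_cell y j (rho s \* u s) (omega s) =
    inner_cell y j (u s \* omega s) (rho s).
  by apply: eq_Rintegral => x _ /=; ring.
have := eq_rho s Js _ (Vrho _ Js) j (ltn_ord j).
rewrite (eq_omega s Js _ (Vomega _ Js) j (ltn_ord j)) cross => /eqP.
by rewrite -mulrDr => /eqP ->; rewrite mulr0.
Unshelve. all: by end_near. Qed.
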